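(* Let $n\ge 1$ be an integer and let $x,y$ be complex numbers such that no denominator below vanishes, i.e. $x\notin\{-1,\dots,-n\}$, $x-y\notin\{-1,\dots,-n\}$ and $y\notin\{-n,-n+1,\dots,n-1\}$. Then $$\sum_{k=0}^n(-1)^k\binom{n}{k}\frac{\binom{y+k}{k}}{\binom{y-n+k}{k}}\frac{y}{y+k}H_{k}^{\langle3\rangle}(x)=\frac{(-1)^n}{2n}\,\frac{\binom{x-y+n}{n}}{\binom{x+n}{n}\binom{y}{n}}\Big\{\big[H_{n}^{\langle2\rangle}(x-y)-H_{n}^{\langle2\rangle}(x)\big]-\big[H_{n}(x-y)-H_{n}(x)\big]^2\Big\}.$$
   Context: For a complex number $u$ and an integer $k\ge 0$, $\binom{u}{k}=\frac{u(u-1)\cdots(u-k+1)}{k!}$ (equal to $1$ for $k=0$). For a complex number $u$ and a positive integer $\ell$, the generalized harmonic numbers of $\ell$-order are $H_0^{\langle\ell\rangle}(u)=0$ and $H_n^{\langle\ell\rangle}(u)=\sum_{k=1}^n\frac{1}{(u+k)^\ell}$ for $n\ge1$; $H_n(u)=H_n^{\langle1\rangle}(u)$. *)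

(* Defs.v *)
From HB Require Import structures.
From mathcomp Require Import all_boot all_order all_algebra.
From mathcomp Require Import complex reals.
Set Implicit Arguments.
Unset Strict Implicit.
Unset Printing Implicit Defensive.
Import GRing.Theory Num.Theory.
Local Open Scope ring_scope.

(* Used at F := R[i] with R : realType, the field of complex numbers;
   dividing by k`! is only meaningful in characteristic 0. *)
Definition gbinom (F : fieldType) (u : F) (k : nat) : F :=
  (\prod_(i < k) (u - i%:R)) / (k`!)%:R.

(* Generalized harmonic number of order l; the empty sum gives 0 at n = 0.
   Only meaningful when u is none of -1, ..., -n (x / 0 is 0 in MathComp). *)
Definition gharmonic (F : fieldType) (l n : nat) (u : F) : F :=
  \sum_(1 <= k < n.+1) 1 / (u + k%:R) ^+ l.

(* Main.v *)
Require Import Defs.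
From mathcomp Require Import all_boot all_order all_algebra.
From mathcomp Require Import complex reals.
From mathcomp Require Import ring zify.
Set Implicit Arguments.
Unset Strict Implicit.
Unset Printing Implicit Defensive.
Import GRing.Theory Num.Theory.
Local Open Scope ring_scope.

(* The coefficients of the harmonic numbers sum up in closed form (Gosper):
   their partial sums are
     U_k = (-1)^k C(n-1,k) (y+1)_k / (y-n+1)_k,   with U_n = 0,
   so summation by parts turns the left-hand side into
     - sum_(k < n) U_k / (x+k+1)^3.
   Up to a factor independent of k, U_k is the residue at z = -(k+1) of
     g(z) = prod_(1 <= j <= n) (z-y+j)/(z+j),
   hence the sum is a multiple of g''(x), and the right-hand side is g''(x)
   computed by logarithmic differentiation. The partial fraction expansion of
   g and its first two derivatives are obtained algebraically, for arbitrary
   zeros c_j and distinct poles a_j, by induction on the number of factors. *)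

(** * Partial fractions of a product of ratios and their first two derivatives *)

Definition ratio_prod (F : fieldType) (a c : nat -> F) (n : nat) (z : F) : F :=
  \prod_(j < n) ((z - c j) / (z - a j)).

Definition ratio_residue (F : fieldType) (a c : nat -> F) (n k : nat) : F :=
  (\prod_(j < n) (a k - c j)) / \prod_(j < n | val j != k) (a k - a j).

(** With g = [ratio_prod], the orders l = 1, 2, 3 give g - 1, -g' and g''/2; l = 0 is the sum of the
    residues. *)
Definition residue_sum (F : fieldType) (a c : nat -> F) (l n : nat) (z : F) : F :=
  \sum_(k < n) ratio_residue a c n k / (z - a k) ^+ l.

(** For l = 1 this is g'/g, for l = 2 minus the derivative of g'/g. *)
Definition inverse_power_diff (F : fieldType) (a c : nat -> F) (l n : nat)
    (z : F) : F :=
  \sum_(j < n) (1 / (z - c j) ^+ l - 1 / (z - a j) ^+ l).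

Lemma ratio_residueS (F : fieldType) (a c : nat -> F) (n k : nat) : (k < n)%N ->
  ratio_residue a c n.+1 k
  = ratio_residue a c n k * ((a k - c n) / (a k - a n)).
Proof.
move=> ltkn; rewrite /ratio_residue big_ord_recr /= [in X in _ / X]big_mkcond.
rewrite big_ord_recr /= -big_mkcond /= eq_sym ltn_eqF //=.
by rewrite invfM mulrACA.
Qed.

Lemma ratio_residue_last (F : fieldType) (a c : nat -> F) (n : nat) :
  ratio_residue a c n.+1 n = (a n - c n) * ratio_prod a c n (a n).
Proof.
rewrite /ratio_residue /ratio_prod big_ord_recr /=.
rewrite [in X in _ / X]big_mkcond big_ord_recr /= eqxx mulr1 -big_mkcond /=.
rewrite [in X in _ / X](eq_bigl xpredT) => [|j]; last by rewrite /= neq_ltn ltn_ord.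
by rewrite prodf_div; ring.
Qed.

(* From ratio_residueS and (z - a_n) - (z - a_k) = a_k - a_n. *)
Lemma residue_sumS (F : fieldType) (a c : nat -> F) (l n : nat) (z : F) :
  (forall k, (k < n)%N -> a k != a n) ->
  (forall j, (j < n.+1)%N -> z != a j) ->
  (z - a n) * residue_sum a c l.+1 n.+1 z
  = (z - c n) * residue_sum a c l.+1 n z
    + (residue_sum a c l n.+1 z - residue_sum a c l n z).
Proof.
move=> da hz.
have zn : z - a n != 0 by rewrite subr_eq0 hz.
rewrite /residue_sum !big_ord_recr /= addrAC -sumrB mulrDr addrA; congr (_ + _).
  rewrite !mulr_sumr -big_split /=; apply: eq_bigr => k _.
  have zk : z - a k != 0 by rewrite subr_eq0 hz // ltnW // ltnS.
  have ak : a k - a n != 0 by rewrite subr_eq0 da.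
  rewrite ratio_residueS // exprS.
  by field; rewrite expf_neq0 //; apply/and3P; split.
by rewrite exprS invfM mulrCA; congr (_ * _); rewrite mulrA divff ?mul1r.
Qed.

(** At an old pole the new factor is 1 + (a_n - c_n)/(a_k - a_n), so the old residues change in
    total by -(a_n - c_n)(g(a_n) - 1), while the new residue is (a_n - c_n) g(a_n). *)
Lemma residue_sum0S (F : fieldType) (a c : nat -> F) (n : nat) :
  (forall k, (k < n)%N -> a k != a n) ->
  residue_sum a c 1 n (a n) = ratio_prod a c n (a n) - 1 ->
  residue_sum a c 0 n.+1 (a n) = residue_sum a c 0 n (a n) + (a n - c n).
Proof.
move=> da E; rewrite /residue_sum big_ord_recr /= ratio_residue_last.
rewrite -[ratio_prod _ _ _ _](subrK 1) -{}E mulrDr mulr1 expr0 divr1 addrA.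
congr (_ + _); rewrite /residue_sum mulr_sumr -big_split /=.
apply: eq_bigr => k _; rewrite ratio_residueS //.
have ak : a k - a n != 0 by rewrite subr_eq0 da.
have ka : a n - a k != 0 by rewrite -opprB oppr_eq0.
by rewrite !expr0 expr1 !divr1; field; rewrite ak ka.
Qed.

Lemma residue_sum0_indep (F : fieldType) (a c : nat -> F) (n : nat) (z t : F) :
  residue_sum a c 0 n z = residue_sum a c 0 n t.
Proof. by apply: eq_bigr => k _; rewrite !expr0. Qed.

Lemma residue_sum1 (F : fieldType) (a c : nat -> F) (n : nat) (z : F) :
  (forall j k, (j < k)%N -> (k < n)%N -> a j != a k) ->
  (forall j, (j < n)%N -> z != a j) ->
  residue_sum a c 1 n z = ratio_prod a c n z - 1.
Proof.
elim: n z => [|n IHn] z da hz.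
  by rewrite /residue_sum /ratio_prod !big_ord0 subrr.
have dn k : (k < n)%N -> a k != a n by move=> ltkn; rewrite da.
(* The induction hypothesis is used at two points: at z and at the new pole [a n]. *)
have IH t : (forall j, (j < n)%N -> t != a j) ->
    residue_sum a c 1 n t = ratio_prod a c n t - 1.
  by move=> ht; apply: IHn => // j k ltjk ltkn; rewrite da // ltnS ltnW.
have zn : z - a n != 0 by rewrite subr_eq0 hz.
apply: (mulfI zn); rewrite residue_sumS //.
rewrite (residue_sum0_indep _ _ _ _ (a n)).
rewrite (residue_sum0_indep _ _ n z (a n)) residue_sum0S //; last first.
  by apply: IH => j ltjn; rewrite eq_sym dn.
rewrite IH => [|j ltjn]; last by rewrite hz // ltnS ltnW.
by rewrite /ratio_prod big_ord_recr /=; field.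
Qed.

(* The first two derivatives in z of the partial fraction expansion
   residue_sum1, i.e. logarithmic differentiation of ratio_prod. *)
Lemma residue_sum23 (F : fieldType) (a c : nat -> F) (n : nat) (z : F) :
  (2%:R : F) != 0 ->
  (forall j k, (j < k)%N -> (k < n)%N -> a j != a k) ->
  (forall j, (j < n)%N -> z != a j) ->
  (forall j, (j < n)%N -> z != c j) ->
  residue_sum a c 2 n z = - ratio_prod a c n z * inverse_power_diff a c 1 n z
  /\ residue_sum a c 3 n z
     = ratio_prod a c n z / 2
       * (inverse_power_diff a c 1 n z ^+ 2 - inverse_power_diff a c 2 n z).
Proof.
move=> two0; elim: n => [|n IHn] da hz hc.
  by rewrite /residue_sum /ratio_prod /inverse_power_diff !big_ord0; split; ring.
have [|j lj|j lj|IH2 IH3] := IHn.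
- by move=> j k ltjk ltkn; rewrite da // ltnS ltnW.
- by rewrite hz // ltnS ltnW.
- by rewrite hc // ltnS ltnW.
have dn k : (k < n)%N -> a k != a n by move=> ltkn; rewrite da.
have zn : z - a n != 0 by rewrite subr_eq0 hz.
have cn : z - c n != 0 by rewrite subr_eq0 hc.
have S1 := residue_sum1 c da hz.
have S1' : residue_sum a c 1 n z = ratio_prod a c n z - 1.
  apply: residue_sum1 => [j k ltjk ltkn|j lj]; first by rewrite da // ltnS ltnW.
  by rewrite hz // ltnS ltnW.
have Pn : ratio_prod a c n.+1 z
    = ratio_prod a c n z * ((z - c n) / (z - a n)).
  by rewrite /ratio_prod big_ord_recr.
have Dn l : inverse_power_diff a c l n.+1 z
    = inverse_power_diff a c l n z + (1 / (z - c n) ^+ l - 1 / (z - a n) ^+ l).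
  by rewrite /inverse_power_diff big_ord_recr.
(* The recurrence gets each order from the one below: order 2 from the expansion itself, order 3
   from order 2, hence the joint induction. *)
have S2 : residue_sum a c 2 n.+1 z
    = - ratio_prod a c n.+1 z * inverse_power_diff a c 1 n.+1 z.
  apply: (mulfI zn); rewrite residue_sumS // IH2 S1 S1' Pn Dn.
  by rewrite !expr1; field; rewrite zn cn.
split=> //; apply: (mulfI zn); rewrite residue_sumS // IH2 IH3 S2 Pn !Dn.
by rewrite !expr1; field; rewrite zn cn two0.
Qed.

(** * Rising and falling factorials *)

Lemma gbinom_rising (F : fieldType) (u : F) (k : nat) :
  gbinom (u + k%:R) k = (\prod_(i < k) (u + i.+1%:R)) / k`!%:R.
Proof.
rewrite /gbinom (reindex_inj rev_ord_inj) /=; congr (_ / _).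
by apply: eq_bigr => i _; rewrite natrB //; ring.
Qed.

Lemma prod_succ_factorial (F : fieldType) (n : nat) :
  \prod_(j < n) (j.+1%:R : F) = n`!%:R.
Proof.
elim: n => [|n IHn]; first by rewrite big_ord0.
by rewrite big_ord_recr /= IHn factS mulnC natrM.
Qed.

Lemma prod_below_diag (F : fieldType) (n : nat) :
  \prod_(j < n) (j%:R - n%:R : F) = (-1) ^+ n * n`!%:R.
Proof.
rewrite (reindex_inj rev_ord_inj) /= -prod_succ_factorial.
rewrite -[n in (-1) ^+ n]card_ord -prodrN.
by apply: eq_bigr => j _; rewrite natrB //; ring.
Qed.

(** The factors with j < k give (-1)^k k!, those with j > k give (n-k-1)!. *)
Lemma prod_off_diag (F : fieldType) (n k : nat) : (k < n)%N ->
  \prod_(j < n | val j != k) (j%:R - k%:R : F)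
  = (-1) ^+ k * (k`! * (n - k.+1)`!)%:R.
Proof.
elim: n => // n IHn; rewrite ltnS leq_eqVlt => /predU1P[->|ltkn].
  rewrite big_mkcond big_ord_recr /= eqxx mulr1 -big_mkcond /= subnn muln1.
  rewrite -prod_below_diag.
  by apply: eq_bigl => j; rewrite /= neq_ltn ltn_ord.
rewrite big_mkcond big_ord_recr /= -big_mkcond /= IHn // gtn_eqF //=.
rewrite subSn // factS -natrB ?(ltnW ltkn) // -mulrA -natrM subnSK //.
by congr (_ * _%:R); ring.
Qed.

(** Each side is the product of y + m over 1-n <= m <= k, cut after m = k-n on the left and after m
    = 0 on the right. *)
Lemma rising_shift (F : fieldType) (y : F) (n k : nat) :
  (\prod_(j < n) (y + k%:R - j%:R)) * (\prod_(i < k) (y - n%:R + i.+1%:R))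
  = (\prod_(i < k) (y + i.+1%:R)) * \prod_(j < n) (y - j%:R).
Proof.
elim: k => [|k IHk]; first by rewrite !big_ord0 mulr1 mul1r addr0.
rewrite !big_ord_recr /= [RHS]mulrAC -{}IHk mulrA mulrAC [RHS]mulrAC.
congr (_ * _).
case: n => [|n]; first by rewrite !big_ord0; ring.
rewrite [in LHS]big_ord_recl [in RHS]big_ord_recr /=.
rewrite (eq_bigr (fun j : 'I_n => y + k%:R - j%:R)) => [|j _].
  by rewrite -!natr1; ring.
by rewrite /bump /= add1n -!natr1; ring.
Qed.

(** * Telescoping of the coefficients and summation by parts *)

Definition partial_sum_term (F : fieldType) (n : nat) (y : F) (k : nat) : F :=
  (-1) ^+ k * 'C(n.-1, k)%:R
  * \prod_(i < k) ((y + i.+1%:R) / (y - n%:R + i.+1%:R)).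

(* The coefficient of the k-th harmonic number, with y/(y+k) absorbed:
   (-1)^k C(n,k) (y)_k / (y-n+1)_k in Pochhammer notation. *)
Definition summand (F : fieldType) (n : nat) (y : F) (k : nat) : F :=
  (-1) ^+ k * 'C(n, k)%:R
  * \prod_(i < k) ((y + i%:R) / (y - n%:R + i.+1%:R)).

(** Once the common factor is removed, Pascal's rule reduces this to (k+1) C(n-1,k+1) = (n-1-k)
    C(n-1,k). *)
Lemma summandS (F : numFieldType) (n : nat) (y : F) (k : nat) :
  (0 < n)%N -> y - n%:R + k.+1%:R != 0 ->
  (forall i, (i < k)%N -> y - n%:R + i.+1%:R != 0) ->
  summand n y k.+1
  = partial_sum_term n y k.+1 - partial_sum_term n y k.
Proof.
case: n => // n _ hk hi; rewrite /summand /partial_sum_term /=.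
rewrite !prodf_div big_ord_recl /= addr0.
rewrite (eq_bigr (fun i : 'I_k => y + i.+1%:R)) => [|i _]; last by [].
rewrite !big_ord_recr /=.
set p := \prod_(i < k) (y + _); set q := \prod_(i < k) _.
have q0 : q != 0 by apply/prodf_neq0 => i _; apply: hi.
have Cn : k.+1%:R * 'C(n, k.+1)%:R = (n%:R - k%:R) * 'C(n, k)%:R :> F.
  case: (leqP k n) => [lekn|ltnk].
    by rewrite -natrB // -!natrM mul_bin_left.
  by rewrite !bin_small ?mulr0 // ltnS ltnW.
have Cn' : 'C(n, k.+1)%:R = (n%:R - k%:R) * 'C(n, k)%:R / k.+1%:R :> F.
  by rewrite -Cn mulrC mulKf // pnatr_eq0.
rewrite binS natrD Cn' exprS -!natr1 in hk *.
have k0 : k%:R + 1 != 0 :> F by rewrite natr1 pnatr_eq0.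
by field; rewrite q0 hk k0.
Qed.

(** The inner sum is empty at k = 0, so the relation between [T] and [U] starts at index 1 of
    [T]. *)
Lemma sum_by_parts (F : comPzRingType) (T U h : nat -> F) (n : nat) :
  (forall k, (k < n)%N -> T k.+1 = U k.+1 - U k) ->
  \sum_(k < n.+1) T k * (\sum_(i < k) h i)
  = U n * (\sum_(i < n) h i) - \sum_(k < n) U k * h k.
Proof.
elim: n => [|n IHn] TU.
  by rewrite big_ord_recr !big_ord0 /= mulr0 subr0 addr0 mulr0.
rewrite big_ord_recr /= IHn => [|k ltkn]; last by rewrite TU // ltnS ltnW.
by rewrite TU // !(big_ord_recr n) /=; ring.
Qed.

(** At the pole -(k+1) the numerator is (-1)^n times a falling factorial of y + k, which
    [rising_shift] converts; the denominator (-1)^k k! (n-1-k)! turns (n-1)! into C(n-1,k). *)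
Lemma partial_sum_term_residue (F : numFieldType) (n : nat) (y : F) (k : nat) :
  (k < n)%N ->
  (forall j, (j < n)%N -> y - j%:R != 0) ->
  (forall i, (i < k)%N -> y - n%:R + i.+1%:R != 0) ->
  partial_sum_term n y k
  = (-1) ^+ n * n.-1`!%:R / (\prod_(j < n) (y - j%:R))
    * ratio_residue (fun j => - j.+1%:R) (fun j => y - j.+1%:R) n k.
Proof.
move=> ltkn hj hi; rewrite /partial_sum_term /ratio_residue.
have -> : \prod_(j < n) (- k.+1%:R - (y - j.+1%:R))
    = \prod_(j < n) - (y + k%:R - j%:R).
  by apply: eq_bigr => j _; rewrite -!natr1; ring.
have -> : \prod_(j < n | val j != k) (- k.+1%:R - - j.+1%:R)
    = \prod_(j < n | val j != k) (j%:R - k%:R : F).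
  by apply: eq_bigr => j _; rewrite -!natr1; ring.
rewrite prod_off_diag // prodrN card_ord prodf_div.
have := rising_shift y n k.
set A := \prod_(j < n) _; set B := \prod_(i < k) _.
set C := \prod_(i < k) _; set D := \prod_(j < n) _ => E.
have B0 : B != 0 by apply/prodf_neq0 => i _; apply: hi.
have D0 : D != 0 by apply/prodf_neq0 => j _; apply: hj.
have k0 : k`!%:R != 0 :> F by rewrite pnatr_eq0 -lt0n fact_gt0.
have nk0 : (n - k.+1)`!%:R != 0 :> F by rewrite pnatr_eq0 -lt0n fact_gt0.
have lek : (k <= n.-1)%N by rewrite -ltnS (ltn_predK ltkn).
have -> : n.-1`!%:R = 'C(n.-1, k)%:R * (k`!%:R * (n - k.+1)`!%:R) :> F.
  by rewrite -!natrM -(bin_fact lek) -subn1 -subnDA add1n.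
have -> : C = A * B / D by rewrite E mulfK.
rewrite natrM.
have s2 (m : nat) : (-1) ^+ m * (-1) ^+ m = 1 :> F by rewrite -expr2 sqrr_sign.
have sk0 : (-1) ^+ k != 0 :> F by rewrite signr_eq0.
(* The right side has (-1)^n twice and (-1)^k inverted; the left is given the same signs. *)
rewrite -[in LHS]invr_sign -[LHS]mul1r -{1}(s2 n); field.
by rewrite B0 D0 k0 nk0 sk0.
Qed.

(** * Translation to binomial coefficients and harmonic numbers *)

Lemma gharmonic_ord (F : fieldType) (l n : nat) (u : F) :
  gharmonic l n u = \sum_(i < n) 1 / (u + i.+1%:R) ^+ l.
Proof. by rewrite /gharmonic big_add1 big_mkord. Qed.

Lemma summandE (F : numFieldType) (n : nat) (y : F) (k : nat) :
  y + k%:R != 0 ->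
  (-1) ^+ k * 'C(n, k)%:R * (gbinom (y + k%:R) k / gbinom (y - n%:R + k%:R) k)
    * (y / (y + k%:R)) = summand n y k.
Proof.
move=> yk; rewrite !gbinom_rising /summand prodf_div.
have k0 : k`!%:R != 0 :> F by rewrite pnatr_eq0 -lt0n fact_gt0.
rewrite -!mulrA; congr (_ * (_ * _)).
(* Times y + k, both sides are y (y+1) ... (y+k), split at its last or its first factor. *)
have E : \prod_(i < k) (y + i%:R) = (\prod_(i < k) (y + i.+1%:R)) * y / (y + k%:R).
  apply: (mulIf yk); rewrite mulfVK // mulrC [RHS]mulrC.
  rewrite -[X in X * \prod_(i < k) (y + i.+1%:R)]addr0.
  rewrite -(big_ord_recl k (fun i : 'I_k.+1 => y + i%:R)) big_ord_recr /=.
  by rewrite mulrC.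
rewrite E invfM invrK; set q := (\prod_(i < k) _)^-1.
by field; rewrite yk k0.
Qed.

Lemma ratio_prod_gbinom (F : numFieldType) (n : nat) (x y : F) :
  ratio_prod (fun j => - j.+1%:R) (fun j => y - j.+1%:R) n x
  = gbinom (x - y + n%:R) n / gbinom (x + n%:R) n.
Proof.
have n0 : n`!%:R != 0 :> F by rewrite pnatr_eq0 -lt0n fact_gt0.
rewrite !gbinom_rising invfM invrK mulrACA mulVf // mulr1 -prodf_div.
by apply: eq_bigr => j _; rewrite opprK opprB addrA (addrAC x).
Qed.

Lemma inverse_power_diff_gharmonic (F : fieldType) (l n : nat) (x y : F) :
  inverse_power_diff (fun j => - j.+1%:R) (fun j => y - j.+1%:R) l n x
  = gharmonic l n (x - y) - gharmonic l n x.
Proof.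
rewrite !gharmonic_ord -sumrB; apply: eq_bigr => j _.
by rewrite opprK opprB addrA (addrAC x).
Qed.

Lemma gharmonic3_alternating_sum (F : numFieldType) (n : nat) (x y : F)
  (hn : (1 <= n)%N)
  (hx : forall j : nat, (1 <= j <= n)%N -> x <> - j%:R)
  (hxy : forall j : nat, (1 <= j <= n)%N -> x - y <> - j%:R)
  (hy : forall j : int, - (n%:Z) <= j <= n%:Z - 1 -> y <> j%:~R) :
  \sum_(0 <= k < n.+1)
     (-1) ^+ k * ('C(n, k))%:R
     * (gbinom (y + k%:R) k / gbinom (y - n%:R + k%:R) k)
     * (y / (y + k%:R)) * gharmonic 3 k x
  = (-1) ^+ n / (2 * n%:R)
    * (gbinom (x - y + n%:R) n / (gbinom (x + n%:R) n * gbinom y n))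
    * ((gharmonic 2 n (x - y) - gharmonic 2 n x)
       - (gharmonic 1 n (x - y) - gharmonic 1 n x) ^+ 2).
Proof.
(* In [hy], the integers -n, ..., 0 keep y + k nonzero; 0, ..., n-1 do so for the factors of
   binom(y,n) and binom(y-n+k,k). *)
have yD k : (k <= n)%N -> y + k%:R != 0.
  move=> lekn; apply/eqP => /eqP; rewrite addr_eq0 => /eqP yk.
  apply: (hy (- k%:Z)); last by rewrite mulrNz.
  by lia.
have yB j : (j < n)%N -> y - j%:R != 0.
  move=> ltjn; rewrite subr_eq0; apply/eqP => yj.
  by apply: (hy j%:Z) => //; lia.
have yBn i : (i < n)%N -> y - n%:R + i.+1%:R != 0.
  move=> ltin.
  have -> : y - n%:R + i.+1%:R = y - (n - i.+1)%:R by rewrite natrB //; ring.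
  by apply: yB; lia.
set a := fun j => - j.+1%:R : F; set c := fun j => y - j.+1%:R.
have xa j : (j < n)%N -> x != a j by move=> lt; apply/eqP/hx.
have xc j : (j < n)%N -> x != c j.
  move=> lt; apply/eqP => E; apply: (hxy j.+1) => //.
  by rewrite E /c; ring.
have aa j k : (j < k)%N -> (k < n)%N -> a j != a k.
  by move=> lt _; rewrite eqr_opp eqr_nat eqSS ltn_eqF.
have two0 : (2 : F) != 0 by rewrite pnatr_eq0.
have [_ S3] := residue_sum23 two0 aa xa xc.
rewrite /a /c ratio_prod_gbinom !inverse_power_diff_gharmonic in S3.
rewrite big_mkord.
under eq_bigr => k _ do rewrite summandE ?yD -1?ltnS // gharmonic_ord.
rewrite (sum_by_parts (T := summand n y) (U := partial_sum_term n y)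
  (fun i => 1 / (x + i.+1%:R) ^+ 3)); last first.
  move=> k ltkn; apply: summandS => //; first exact: yBn.
  by move=> i ltik; rewrite yBn // (ltn_trans ltik).
(* The boundary term contains ['C(n.-1, n)], which is 0 since n >= 1. *)
rewrite [X in X * _]/partial_sum_term bin_small ?prednK // mulr0 !mul0r sub0r.
rewrite (eq_bigr (fun k : 'I_n =>
  (-1) ^+ n * n.-1`!%:R / (\prod_(j < n) (y - j%:R))
    * (ratio_residue a c n k / (x - a k) ^+ 3))); last first.
  move=> k _; rewrite partial_sum_term_residue // => [|i ltik].
    by rewrite opprK -!mulrA mul1r.
  by rewrite yBn // (ltn_trans ltik).
rewrite -mulr_sumr [X in _ * X]S3.
have D0 : \prod_(j < n) (y - j%:R) != 0 by apply/prodf_neq0 => j _; apply: yB.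
(* Splitting n! as n (n-1)! absorbs the constant of the residues into 1/(n binom(y,n)); with the 1/2
   of g''/2 this gives 1/(2n). *)
have gy : gbinom y n = (\prod_(j < n) (y - j%:R)) / (n%:R * n.-1`!%:R).
  by rewrite /gbinom -natrM -[in n`!](prednK hn) factS prednK.
have f0 : n.-1`!%:R != 0 :> F by rewrite pnatr_eq0 -lt0n fact_gt0.
have n0 : n%:R != 0 :> F by rewrite pnatr_eq0 -lt0n.
rewrite gy.
(* Both sides contain binom(x+n,n) only inverted; generalizing the inverse spares [field] a side
   condition. *)
move: (gbinom (x - y + _) n) (gbinom (x + _) n) => u v.
rewrite (invfM v); move: v^-1 => {}v.
by field; rewrite D0 f0 n0.
Qed.

Theorem theorem10 (R : realType) (n : nat) (x y : R[i])
  (hn : (1 <= n)%N)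
  (hx : forall j : nat, (1 <= j <= n)%N -> x <> - j%:R)
  (hxy : forall j : nat, (1 <= j <= n)%N -> x - y <> - j%:R)
  (hy : forall j : int, - (n%:Z) <= j <= n%:Z - 1 -> y <> j%:~R) :
  \sum_(0 <= k < n.+1)
     (-1) ^+ k * ('C(n, k))%:R
     * (gbinom (y + k%:R) k / gbinom (y - n%:R + k%:R) k)
     * (y / (y + k%:R)) * gharmonic 3 k x
  = (-1) ^+ n / (2 * n%:R)
    * (gbinom (x - y + n%:R) n / (gbinom (x + n%:R) n * gbinom y n))
    * ((gharmonic 2 n (x - y) - gharmonic 2 n x)
       - (gharmonic 1 n (x - y) - gharmonic 1 n x) ^+ 2).
Proof. exact: gharmonic3_alternating_sum. Qed.
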